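(* Let $1\le i<j<k$ be integers and let $$\sigma=\sigma_1\text{-}\sigma_2\cdots\sigma_{k+1}$$ be a vincular pattern with $\sigma_1\cdots\sigma_{k+1}$ a permutation of $\{1,\dots,k+1\}$. Let $\tau=\tau_1\text{-}\tau_2\cdots\tau_{k+1}$ where $\tau_{i+2},\dots,\tau_{j+1}$ is a permutation of $\sigma_{i+2},\dots,\sigma_{j+1}$ and $\tau_x=\sigma_x$ for $x\in[1,i+1]\cup[j+2,k+1]$. Suppose that for every integer $z$ with $\min(i,k-j)<z<k$ all of the following hold: $$\sigma_2\cdots\sigma_{z+1}\not\sim\sigma_{k-z+2}\cdots\sigma_{k+1},\qquad \sigma_2\cdots\sigma_{z+1}\not\sim\tau_{k-z+2}\cdots\tau_{k+1},$$ $$\tau_2\cdots\tau_{z+1}\not\sim\sigma_{k-z+2}\cdots\sigma_{k+1},\qquad \tau_2\cdots\tau_{z+1}\not\sim\tau_{k-z+2}\cdots\tau_{k+1}.$$ Then $\sigma$ and $\tau$ are filling-shape-Wilf-equivalent: $\sigma\equiv_{\mathrm{fs}}\tau$.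
   Context: Two sequences of positive integers of the same length are order-isomorphic, $a_1\cdots a_k\sim b_1\cdots b_k$, if for all $p,q$ one has $a_p<a_q$ iff $b_p<b_q$. A vincular pattern of length $\ell$ is a pair $(\sigma,T)$ with $\sigma$ a permutation of $\{1,\dots,\ell\}$ and $T\subseteq\{1,\dots,\ell-1\}$. It is written as the word $\sigma_1\cdots\sigma_\ell$ with a dash between $\sigma_p$ and $\sigma_{p+1}$ exactly when $p\notin T$. Thus $\sigma_1\text{-}\sigma_2\cdots\sigma_{k+1}$ has $T=\{2,\dots,k\}$. Young diagrams are drawn in French notation: a Young diagram $D$ with $n$ columns and $m$ rows is a set of cells (column, row) in $\{1,\dots,n\}\times\{1,\dots,m\}$ such that if $(a,b)\in D$ then $(a',b')\in D$ for all $1\le a'\le a$, $1\le b'\le b$; the cell $(1,1)$ is at the bottom left. A filling of $D$ is a set of selected cells of $D$ with no two in the same column and no two in the same row. For a column $c$ containing a selected cell, let $\pi(c)$ be the row of that cell. A filling contains the vincular pattern $(\sigma,T)$ of length $\ell$ if there are columns $i_1<\cdots<i_\ell$ such that: $(i_1,\pi(i_1)),\dots,(i_\ell,\pi(i_\ell))$ are selected cells; $\pi(i_1)\cdots\pi(i_\ell)\sim\sigma_1\cdots\sigma_\ell$; $(i_p,\pi(i_q))\in D$ for all $1\le p,q\le \ell$; and $i_{p+1}-i_p=1$ for all $p\in T$. Otherwise it avoids the pattern. Two vincular patterns $\sigma,\tau$ are filling-shape-Wilf-equivalent, $\sigma\equiv_{\mathrm{fs}}\tau$, if for every Young diagram $D$,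 every set $R$ of rows and every set $C$ of columns, the number of fillings of $D$ avoiding $\sigma$ whose set of rows without a selected cell is exactly $R$ and whose set of columns without a selected cell is exactly $C$ equals the number of such fillings avoiding $\tau$. *)

(* Defs.v *)
From mathcomp Require Import all_boot all_fingroup.

Set Implicit Arguments.
Unset Strict Implicit.
Unset Printing Implicit Defensive.

(* Columns, rows and positions are 0-based ordinals; entries of words are     *)
(* shifted back to positive integers.                                         *)

Definition order_iso (a b : seq nat) : bool :=
  (size a == size b) &&
  [forall p : 'I_(size a), forall q : 'I_(size a),
     (nth 0 a p < nth 0 a q) == (nth 0 b p < nth 0 b q)].

Definition word l (s : 'S_l) : seq nat := [seq (s p).+1 | p <- enum 'I_l].

(* The factor w_a ... w_b, with 1-based inclusive bounds, 0 < a. *)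
Definition factor (w : seq nat) (a b : nat) : seq nat :=
  take (b.+1 - a) (drop a.-1 w).

(* In a vincular pattern (s, T), t : 'I_l.-1 in T means that the entries at   *)
(* 0-based positions t and t.+1 are written without a dash between them.      *)
Definition vincular (l : nat) : Type := ('S_l * {set 'I_l.-1})%type.

(* s_1-s_2...s_(k+1): the only dash is after the first letter. *)
Definition one_dash k (s : 'S_k.+1) : vincular k.+1 :=
  (s, [set t : 'I_k | 0 < t]).

Section Fillings.

Variables n m : nat.
Implicit Types D F : {set 'I_n * 'I_m}.

(* Cells are pairs (column, row). *)
Definition young D : Prop :=
  forall (a a' : 'I_n) (b b' : 'I_m),
    (a, b) \in D -> a' <= a -> b' <= b -> (a', b') \in D.

Definition filling D F : bool :=
  (F \subset D) &&
  [forall x in F, forall y in F,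
     ((x.1 == y.1) || (x.2 == y.2)) ==> (x == y)].

(* When F is a filling, r p is forced to be the row of the selected cell of   *)
(* column c p.                                                                *)
Definition contains D F l (v : vincular l) : bool :=
  [exists c : {ffun 'I_l -> 'I_n}, exists r : {ffun 'I_l -> 'I_m},
    [&& [forall p : 'I_l, forall q : 'I_l, (p < q) ==> (c p < c q)],
        [forall p, (c p, r p) \in F],
        order_iso [seq (r p).+1 | p <- enum 'I_l] (word v.1),
        [forall p, forall q, (c p, r q) \in D] &
        [forall t in v.2, forall p : 'I_l, forall q : 'I_l,
           (p == t :> nat) && (q == t.+1 :> nat) ==>
           (c q == (c p).+1 :> nat)]]].

Definition empty_rows F : {set 'I_m} :=
  [set b | [forall a, (a, b) \notin F]].

Definition empty_cols F : {set 'I_n} :=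
  [set a | [forall b, (a, b) \notin F]].

Definition avoiders D l (v : vincular l) (R : {set 'I_m}) (C : {set 'I_n}) :
    {set {set 'I_n * 'I_m}} :=
  [set F | [&& filling D F, ~~ contains D F v,
               empty_rows F == R & empty_cols F == C]].

End Fillings.

Definition fs_equiv l l' (v : vincular l) (w : vincular l') : Prop :=
  forall (n m : nat) (D : {set 'I_n * 'I_m}), young D ->
  forall (R : {set 'I_m}) (C : {set 'I_n}),
    #|avoiders D v R C| = #|avoiders D w R C|.

(* Main.v *)
Require Import Defs.
From mathcomp Require Import all_boot all_fingroup.
From mathcomp Require Import zify.

(* Call a column [a] marked by [s] when some occurrence of the pattern has its
   contiguous part in columns a, ..., a+k-1. The overlap hypothesis forces the
   middles (columns a+i, ..., a+j-1) of marked blocks to miss all other marked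
   blocks, so for a fixed set S of columns the middles of the blocks starting in
   S can be rearranged independently, turning the contiguous part of [s] into
   that of [t]. The letter before the dash survives as a selected row, its column
   possibly moving inside the middle of an earlier block; the cell condition
   survives because, in a Young diagram, it only involves the last column and the
   highest row of the occurrence. Hence as many fillings have at least the marks
   S for [s] as for [t], and Moebius inversion over S gives the case of no marks. *)

Set Implicit Arguments.
Unset Strict Implicit.
Unset Printing Implicit Defensive.

(** * Order isomorphism of words and of their factors *)

Lemma order_isoP (a b : seq nat) :
  reflect (size a = size b /\ forall p q, p < size a -> q < size a ->
             (nth 0 a p < nth 0 a q) = (nth 0 b p < nth 0 b q))
          (order_iso a b).
Proof.
apply: (iffP andP) => -[/eqP sz h]; split => //; last first.
  by apply/forallP => p; apply/forallP => q; rewrite h.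
move=> p q hp hq.
by move/forallP: h => /(_ (Ordinal hp))/forallP/(_ (Ordinal hq))/eqP.
Qed.

Lemma order_iso_mapP l m (r : 'I_l -> 'I_m) (s : 'S_l) :
  reflect (forall p q, (r p < r q) = (s p < s q))
          (order_iso [seq (r p).+1 | p <- enum 'I_l] (word s)).
Proof.
have nthE (h : 'I_l -> nat) (p : 'I_l) :
    nth 0 [seq h x | x <- enum 'I_l] p = h p.
  by rewrite (nth_map p) ?size_enum_ord // nth_ord_enum.
apply: (iffP (order_isoP _ _)); rewrite /word 2!size_map size_enum_ord.
  by move=> [_ h] p q; have := h p q; rewrite !nthE !ltnS => ->.
move=> h; split=> // p q hp hq.
rewrite -[p]/(val (Ordinal hp)) -[q]/(val (Ordinal hq)).
by rewrite !(nthE (fun x => (r x).+1)) !(nthE (fun x => (s x).+1)) !ltnS.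
Qed.

(** If the contiguous parts of two occurrences overlap in [z] columns, the last [z] letters of the
    row word [r] are the first [z] of [r'] after the dash. These common rows realize both factors.
    Position 0 is the letter before the dash, hence [0 < p]. *)
Lemma order_iso_factors k m (s : 'S_k.+1) (r r' : 'I_k.+1 -> 'I_m) z :
    0 < z -> z < k ->
    (forall p q, (r p < r q) = (s p < s q)) ->
    (forall p q, (r' p < r' q) = (s p < s q)) ->
    (forall p q : 'I_k.+1, 0 < p <= z -> q = p + (k - z) :> nat ->
       r' p = r q) ->
  order_iso (factor (word s) 2 (z + 1)) (factor (word s) (k - z + 2) (k + 1)).
Proof.
move=> z0 zk hr hr' hrr.
have szw : size (word s) = k.+1 by rewrite size_map size_enum_ord.
have nthw (x : nat) (hx : x < k.+1) : nth 0 (word s) x = (s (Ordinal hx)).+1.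
  rewrite (nth_map (Ordinal hx)) ?size_enum_ord //.
  by rewrite -[X in nth _ _ X]/(val (Ordinal hx)) nth_ord_enum.
apply/order_isoP; rewrite /factor !size_take !size_drop szw.
have -> : (z + 1).+1 - 2 = z by lia.
have -> : (k + 1).+1 - (k - z + 2) = z by lia.
have -> : (k - z + 2).-1 = (k - z).+1 by lia.
rewrite /=.
have -> : (if z < k.+1 - 1 then z else k.+1 - 1) = z by case: ifP; lia.
have -> : (if z < k.+1 - (k - z).+1 then z else k.+1 - (k - z).+1) = z.
  by case: ifP; lia.
split=> // p q pz qz.
rewrite !nth_take // !nth_drop.
have p1 : 1 + p < k.+1 by lia.
have q1 : 1 + q < k.+1 by lia.
have p2 : (k - z).+1 + p < k.+1 by lia.
have q2 : (k - z).+1 + q < k.+1 by lia.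
rewrite (nthw _ p1) (nthw _ q1) (nthw _ p2) (nthw _ q2) !ltnS -hr' -hr.
by rewrite (hrr (Ordinal p1) (Ordinal p2)) ?(hrr (Ordinal q1) (Ordinal q2)) //=;
  lia.
Qed.

(** * Marked columns and the overlaps of their blocks *)

Section BlockStarts.

Variables n m k : nat.
Implicit Types (D F : {set 'I_n * 'I_m}) (s t : 'S_k.+1) (a : 'I_n).

(** [a] is the column of position 1, the first letter after the dash; it determines every column
    except that of position 0. *)
Definition occurrence D F s a (c : 'I_k.+1 -> 'I_n) (r : 'I_k.+1 -> 'I_m) :=
  [&& [forall p : 'I_k.+1, (0 < p) ==> (c p == a + p.-1 :> nat)],
      c ord0 < a,
      [forall p, (c p, r p) \in F],
      [forall p, forall q, (r p < r q) == (s p < s q)] &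
      [forall p, forall q, (c p, r q) \in D]].

Lemma occurrenceP D F s a (c : 'I_k.+1 -> 'I_n) (r : 'I_k.+1 -> 'I_m) :
  reflect [/\ forall p : 'I_k.+1, 0 < p -> c p = a + p.-1 :> nat,
              c ord0 < a,
              forall p, (c p, r p) \in F,
              forall p q, (r p < r q) = (s p < s q) &
              forall p q, (c p, r q) \in D]
          (occurrence D F s a c r).
Proof.
apply: (iffP and5P) => -[h1 h2 h3 h4 h5]; split => //.
- by move=> p p0; move/forallP: h1 => /(_ p); rewrite p0 => /eqP.
- by move=> p; move/forallP: h3.
- by move=> p q; move/forallP: h4 => /(_ p) /forallP /(_ q) /eqP.
- by move=> p q; move/forallP: h5 => /(_ p) /forallP /(_ q).
- by apply/forallP => p; apply/implyP => /h1 /eqP.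
- exact/forallP.
- by apply/forallP => p; apply/forallP => q; rewrite h4.
- by apply/forallP => p; apply/forallP.
Qed.

Definition block_starts D F s : {set 'I_n} :=
  [set a | [exists c : {ffun 'I_k.+1 -> 'I_n},
            exists r : {ffun 'I_k.+1 -> 'I_m}, occurrence D F s a c r]].

Lemma block_startsP D F s a :
  reflect (exists c r, occurrence D F s a c r) (a \in block_starts D F s).
Proof.
rewrite inE; apply: (iffP existsP) => [[c /existsP[r h]]|[c [r h]]].
  by exists c, r.
exists [ffun p => c p]; apply/existsP; exists [ffun p => r p].
case/occurrenceP: h => h1 h2 h3 h4 h5.
apply/occurrenceP; split => *; rewrite !ffunE; auto.
Qed.

Lemma contains_one_dash D F s : 0 < k ->
  contains D F (one_dash s) = (block_starts D F s != set0).
Proof.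
move=> k0; apply/idP/set0Pn.
  case/existsP => c /existsP[r /and5P[inc inF ord inD dash]].
  have c1 : 1 < k.+1 by [].
  exists (c (Ordinal c1)); apply/block_startsP; exists c, r.
  apply/occurrenceP; split.
  - case=> p; elim: p => [//|[_|p IHp] hp _].
      by rewrite addn0; congr (nat_of_ord (c _)); apply: val_inj.
    have hp1 : p.+1 < k.+1 by lia.
    have hp2 : p.+1 < k by lia.
    move/forall_inP: dash => /(_ (Ordinal hp2)); rewrite inE => /(_ isT).
    move=> /forallP/(_ (Ordinal hp1))/forallP/(_ (Ordinal hp)).
    by rewrite !eqxx => /eqP ->; rewrite (IHp hp1 isT) /= addnS.
  - by move/forallP: inc => /(_ ord0) /forallP/(_ (Ordinal c1)).
  - exact/forallP.
  - exact/order_iso_mapP.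
  - by move=> p q; move/forallP: inD => /(_ p) /forallP /(_ q).
case=> a; rewrite inE => /existsP[c /existsP[r /occurrenceP[h1 h2 h3 h4 h5]]].
apply/existsP; exists c; apply/existsP; exists r; apply/and5P; split.
- apply/forallP => p; apply/forallP => q; apply/implyP => pq.
  rewrite (h1 q); last by lia.
  have [p0|p0] := posnP p; last by rewrite h1 //; lia.
  have -> : p = ord0 by apply: val_inj.
  exact: leq_trans h2 (leq_addr _ _).
- exact/forallP.
- exact/order_iso_mapP.
- by apply/forallP => p; apply/forallP.
- apply/forall_inP => x; rewrite inE => x0.
  apply/forallP => p; apply/forallP => q; apply/implyP => /andP[/eqP px /eqP qx].
  by apply/eqP; rewrite !h1 ?px ?qx /= -?addnS ?prednK.
Qed.

Lemma filling_rowE D F c b b' :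
  filling D F -> (c, b) \in F -> (c, b') \in F -> b = b'.
Proof.
case/andP => _ /forall_inP h h1 h2.
by move/forall_inP: (h _ h1) => /(_ _ h2) /=; rewrite eqxx /= => /eqP[].
Qed.

Lemma block_start_bound D F s a : 0 < k -> a \in block_starts D F s -> a + k <= n.
Proof.
move=> k0 /block_startsP[c [r /occurrenceP[h1 _ _ _ _]]].
by have := ltn_ord (c ord_max); rewrite h1 //=; lia.
Qed.

(** In a shared column both occurrences use the same selected cell, so an overlap of more than [e]
    columns would make a prefix and a suffix of the contiguous part order-isomorphic. *)
Lemma block_starts_spaced D F s e a a' :
    filling D F ->
    (forall z, e < z -> z < k ->
       ~~ order_iso (factor (word s) 2 (z + 1))
                    (factor (word s) (k - z + 2) (k + 1))) ->
    a \in block_starts D F s -> a' \in block_starts D F s -> a < a' ->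
  a + k <= a' + e.
Proof.
move=> FD hov /block_startsP[c [r /occurrenceP[h1 _ h3 h4 _]]].
move=> /block_startsP[c' [r' /occurrenceP[h1' _ h3' h4' _]]] aa'.
rewrite leqNgt; apply/negP => lt.
pose z := a + k - a'.
have ze : e < z by rewrite /z; lia.
have zk : z < k by rewrite /z; lia.
apply: (negP (hov z ze zk)).
apply: (order_iso_factors _ zk h4 h4'); first by lia.
move=> p q /andP[p0 pz] qE.
have E : c' p = c q by apply: val_inj; rewrite /= h1' // h1 qE /z; lia.
by have := h3' p; rewrite E => Fp; apply: (filling_rowE FD Fp (h3 q)).
Qed.

End BlockStarts.

(** * Rearranging the columns inside the middles *)

Section Shuffle.

Variables (n k i j : nat) (u : 'S_k.+1) (S : {set 'I_n}).
Hypotheses (hjk : j <= k) (uid : forall x : 'I_k.+1, ~~ (i < x <= j) -> u x = x).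
Hypothesis bound : {in S, forall a : 'I_n, a + k <= n}.
Hypothesis spaced :
  {in S &, forall a a' : 'I_n, a < a' -> a + j <= a' /\ a + k <= a' + i}.

Definition middle (a c : nat) := a + i <= c < a + j.

(* For p > 0 the column a + p.-1 of a block carries the p-th (0-based) letter;
   [shuffle] moves it to the column of the letter [u p]. *)
Definition shuffle (c : 'I_n) : 'I_n :=
  if [pick a in S | middle a c] is Some a
  then insubd c (a + (u (inord (c - a).+1)).-1) else c.

(** A middle position sent outside would collide with a fixed point of [u]. *)
Lemma mem_middle (x : 'I_k.+1) : (i < u x <= j) = (i < x <= j).
Proof.
apply/idP/idP => h; apply: contraLR h => h.
  by rewrite uid.
have /perm_inj E := uid h; by rewrite -E.
Qed.

Lemma middle_block a a' p c : a \in S -> a' \in S ->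
  c = a + p.-1 -> 0 < p <= k -> middle a' c -> a' = a.
Proof.
move=> aS a'S -> pk /andP[h1 h2]; apply: val_inj => /=.
by case: (ltngtP a a') => // h;
  [have := spaced aS a'S h|have := spaced a'S aS h]; lia.
Qed.

(** On a whole block the shuffle acts as [u]: a column of the block outside its own middle lies in
    no other middle, and [u] fixes its position. *)
Lemma shuffle_block (a c : 'I_n) (p : 'I_k.+1) : a \in S -> 0 < p ->
  c = a + p.-1 :> nat -> shuffle c = a + (u p).-1 :> nat.
Proof.
move=> aS p0 cE; have pk := ltn_ord p; rewrite /shuffle.
case: pickP => [a' /andP[a'S mid]|/(_ a)].
  have E := middle_block aS a'S cE _ mid; rewrite {}E in mid *; last by lia.
  have -> : (c - a).+1 = p by lia.
  (* By [bound] the target is a genuine column, so the default of [insubd] is not taken. *)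
  rewrite inord_val val_insubd ifT //.
  have := mem_middle p; have := bound aS; rewrite /middle in mid; lia.
rewrite aS /= => /negbT mid; rewrite uid //.
by apply: contra mid; rewrite /middle; lia.
Qed.

Lemma shuffleP (c : 'I_n) :
  shuffle c = c \/
  exists (a : 'I_n) (p : 'I_k.+1), [/\ a \in S, i < p <= j & c = a + p.-1 :> nat].
Proof.
rewrite /shuffle; case: pickP => [a /andP[aS mid]|]; last by left.
rewrite /middle in mid; right; exists a, (inord (c - a).+1).
by rewrite inordK; first split => //; lia.
Qed.

(** This keeps the letter before the dash to the left of its block: a column moved inside an earlier
    middle stays there, and that middle ends before [a]. *)
Lemma shuffle_lt (a c : 'I_n) : a \in S -> c < a -> shuffle c < a.
Proof.
move=> aS ca; have [->//|[a' [p [a'S pij cE]]]] := shuffleP c.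
rewrite (shuffle_block a'S _ cE); last by lia.
have := mem_middle p; have : a' + j <= a; last by lia.
by apply: (spaced a'S aS _).1; lia.
Qed.

Lemma shuffle_inj : injective shuffle.
Proof.
move=> c c' E; apply: val_inj => /=.
(* If a moved column [x] had a fixed image [y], then [y] would sit at position [u p] of the same
   block, so [u (u p) = u p] and [u p = p]. *)
have fixed (x y : 'I_n) : shuffle x = shuffle y -> shuffle y = y -> x = y.
  move=> exy yE; have [<-|[a [p [aS pij xE]]]] := shuffleP x; first by rewrite exy.
  have upij : i < u p <= j by rewrite mem_middle.
  have hx : y = a + (u p).-1 :> nat.
    by rewrite -yE -exy (shuffle_block aS _ xE) //; lia.
  have := shuffle_block aS _ hx; rewrite yE hx => /(_ ltac:(lia)) e.
  have uup : i < u (u p) <= j by rewrite mem_middle.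
  have /perm_inj up : u (u p) = u p by apply: val_inj => /=; lia.
  by apply: val_inj; rewrite /= xE hx up.
have [h|[a' [p' [a'S pij' cE']]]] := shuffleP c'; first by rewrite (fixed c c').
have [h|[a [p [aS pij cE]]]] := shuffleP c; first by rewrite (fixed c' c).
have e : a + (u p).-1 = a' + (u p').-1.
  by rewrite -(shuffle_block aS _ cE) -?(shuffle_block a'S _ cE') ?E //; lia.
have upij : i < u p <= j by rewrite mem_middle.
have upij' : i < u p' <= j by rewrite mem_middle.
(* Both columns are moved, and their common image lies in both middles. *)
have aa : a' = a.
  apply: (middle_block (c := a + (u p).-1) aS a'S erefl); first by lia.
  by rewrite e /middle; lia.
have /perm_inj up : u p = u p' by apply: val_inj => /=; rewrite aa in e; lia.
by rewrite cE cE' aa up.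
Qed.

End Shuffle.

(** * Transporting fillings along the shuffle *)

Section Transport.

Variables (n m k i j : nat) (s t : 'S_k.+1) (S : {set 'I_n}).
Variable D : {set 'I_n * 'I_m}.
Hypotheses (hjk : j <= k) (youngD : young D).
Hypothesis hfix : forall x : 'I_k.+1, ~~ (i < x <= j) -> t x = s x.
Hypothesis bound : {in S, forall a : 'I_n, a + k <= n}.
Hypothesis spaced :
  {in S &, forall a a' : 'I_n, a < a' -> a + j <= a' /\ a + k <= a' + i}.

(** Products act left to right: [u p] is the position in [t] of the letter [s p]. *)
Let u : 'S_k.+1 := (s * t^-1)%g.

Lemma transport_pos_fix (x : 'I_k.+1) : ~~ (i < x <= j) -> u x = x.
Proof. by move=> h; rewrite permM -hfix // permK. Qed.

Let f : 'I_n -> 'I_n := shuffle i j u S.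
Let f_inj : injective f := shuffle_inj hjk transport_pos_fix bound spaced.
Let f_block := shuffle_block hjk transport_pos_fix bound spaced.

Definition transport (F : {set 'I_n * 'I_m}) := [set (f x.1, x.2) | x in F].

Lemma transport_inj : injective transport.
Proof. by apply: imset_inj => -[c b] [c' b'] [/f_inj -> ->]. Qed.

Lemma mem_transport (F : {set 'I_n * 'I_m}) c b : ((f c, b) \in transport F) = ((c, b) \in F).
Proof.
apply/imsetP/idP => [[[c' b'] cF [/f_inj -> ->]]//|cF].
by exists (c, b).
Qed.

Lemma transportP (F : {set 'I_n * 'I_m}) c b :
  reflect (exists2 c', c = f c' & (c', b) \in F) ((c, b) \in transport F).
Proof.
apply: (iffP imsetP) => [[[c' b'] cF [-> ->]]|[c' -> cF]]; first by exists c'.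
by exists (c', b).
Qed.

Variable F : {set 'I_n * 'I_m}.
Hypotheses (FD : filling D F) (SF : S \subset block_starts D F s).

(** A moved column and its target belong to one occurrence of [s], so both carry selected cells and
    the moved cell stays in [D]. *)
Lemma shuffle_moved c : f c = c \/
  exists b b', [/\ (c, b) \in F, (f c, b') \in F & (f c, b) \in D].
Proof.
rewrite /f; have [->|[a [p [aS pij cE]]]] := @shuffleP n k i j u S hjk c; first by left.
right; have /block_startsP[g [r /occurrenceP[h1 _ h3 _ h5]]] := subsetP SF _ aS.
have p0 : 0 < p by lia.
have up0 : 0 < u p.
  by have := mem_middle transport_pos_fix p; lia.
have gp : c = g p by apply: val_inj; rewrite /= cE h1.
have gup : shuffle i j u S c = g (u p) by apply: val_inj; rewrite /= (f_block aS p0 cE) h1.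
by exists (r p), (r (u p)); rewrite gup gp; split.
Qed.

Lemma filling_transport : filling D (transport F).
Proof.
have [/subsetP sub /forall_inP inj] := andP FD; apply/andP; split.
  apply/subsetP => -[d b] /transportP[c -> cF].
  have [->|[b' [_ [cF' _ fD]]]] := shuffle_moved c; first exact: sub.
  by rewrite (filling_rowE FD cF cF').
apply/forall_inP => _ /imsetP[x xF ->]; apply/forall_inP => _ /imsetP[y yF ->].
rewrite /= (inj_eq f_inj); apply/implyP => xy.
by have /forall_inP/(_ _ yF)/implyP/(_ xy)/eqP -> := inj _ xF.
Qed.

Lemma empty_rows_transport : empty_rows (transport F) = empty_rows F.
Proof.
apply/setP => b; rewrite !inE; apply/forallP/forallP => h c.
  by rewrite -mem_transport.
by apply/transportP => -[c' _]; rewrite (negPf (h c')).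
Qed.

Lemma empty_cols_transport : empty_cols (transport F) = empty_cols F.
Proof.
apply/setP => d; have [g _ fg] := injF_bij f_inj; rewrite -(fg d).
move: (g d) => c; rewrite !inE.
(* The column [f c] of the image is empty iff [c] is empty in [F]; if [f c] differs from [c], both
   are nonempty in [F]. *)
transitivity [forall b, (c, b) \notin F].
  by apply: eq_forallb => b; rewrite mem_transport.
have [->//|[b [b' [cF fcF _]]]] := shuffle_moved c.
by apply/forallP/forallP => [/(_ b)|/(_ b')]; rewrite ?cF ?fcF.
Qed.

Lemma block_starts_transport : 0 < k ->
  S \subset block_starts D (transport F) t.
Proof.
move=> k0; apply/subsetP => a aS.
have /block_startsP[c [r /occurrenceP[h1 h2 h3 h4 h5]]] := subsetP SF _ aS.
have up0 p : 0 < u p -> 0 < p.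
  rewrite !lt0n; apply: contraNN => /eqP p0.
  by rewrite transport_pos_fix ?p0.
have tE q : t q = s (u^-1%g q) by rewrite /u invMg invgK permM permKV.
have u0 : u^-1%g ord0 = ord0 by rewrite -[RHS](permK u) transport_pos_fix.
apply/block_startsP.
(* The block keeps its columns and only the column before the dash follows [f]; the cell now at
   position [q] came from position [u^-1 q]. *)
exists (fun q => if q == ord0 then f (c q) else c q), (fun q => r (u^-1%g q)).
have fc0 : f (c ord0) < a.
  exact: (shuffle_lt hjk transport_pos_fix bound spaced).
apply/occurrenceP; split.
- by move=> p p0; rewrite ifN ?h1 //; apply: contraTneq p0 => ->.
- by rewrite eqxx.
- move=> q; case: eqP => [->|/eqP q0]; first by rewrite u0 mem_transport.
  have q0' : 0 < u (u^-1%g q) by rewrite permKV lt0n.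
  have p0 := up0 _ q0'.
  apply/transportP; exists (c (u^-1%g q)) => //; apply: val_inj => /=.
  by rewrite (f_block aS p0 (h1 _ p0)) permKV h1 // lt0n.
- by move=> p q; rewrite h4 !tE.
- move=> p q; case: eqP => // ->.
  (* The new first column is left of [a], so its cells lie in [D] because those of column [a] do. *)
  have k1 : 1 < k.+1 by [].
  apply: youngD (h5 (Ordinal k1) (u^-1%g q)) _ (leqnn _).
  by rewrite h1 // addn0 ltnW.
Qed.

End Transport.

(** * Inversion over sets of marks, and conclusion *)

Lemma eq_card_fibers (T I : finType) (A B : {set T}) (f g : T -> {set I}) :
    (forall S : {set I},
       #|[set x in A | S \subset f x]| = #|[set x in B | S \subset g x]|) ->
  forall S : {set I}, #|[set x in A | f x == S]| = #|[set x in B | g x == S]|.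
Proof.
have split_card (C : {set T}) (h : T -> {set I}) (S : {set I}) :
    #|[set x in C | S \subset h x]| =
      #|[set x in C | h x == S]| +
      \sum_(S' : {set I} | S \proper S') #|[set x in C | h x == S']|.
  rewrite -!sum1dep_card (partition_big h (fun S' => S \subset S')) /=; last first.
    by move=> x /andP[].
  rewrite (bigD1 S) //=; congr (_ + _).
    by apply: eq_bigl => x; rewrite -andbA; case: eqP => [->|]; rewrite ?subxx ?andbF.
  apply: eq_big => [S'|S' /andP[SS' _]]; first by rewrite properEneq eq_sym andbC.
  rewrite -sum1dep_card; apply: eq_bigl => x; rewrite -andbA.
  by case: eqP => [->|]; rewrite ?SS' ?andbF.
(* Induction on the size of the complement of [S]: the counts for proper supersets already agree and
   cancel. *)
move=> h S; have [e] := ubnP #|~: S|; elim: e S => // e IHe S; rewrite ltnS => Se.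
have := h S; rewrite !split_card.
rewrite (eq_bigr (fun S' => #|[set x in B | g x == S']|)).
  by move/addIn.
move=> S' SS'; apply: IHe; apply: leq_trans Se.
by apply: proper_card; rewrite properE !setCS -properE.
Qed.

Definition fillings n m (D : {set 'I_n * 'I_m}) R C :=
  [set F | [&& filling D F, empty_rows F == R & empty_cols F == C]].

Lemma leq_card_marked k i j n m (s t : 'S_k.+1) (D : {set 'I_n * 'I_m}) R C
    (S : {set 'I_n}) :
    0 < k -> j <= k -> young D ->
    (forall x : 'I_k.+1, ~~ (i < x <= j) -> t x = s x) ->
    (forall z, minn i (k - j) < z -> z < k ->
       ~~ order_iso (factor (word s) 2 (z + 1))
                    (factor (word s) (k - z + 2) (k + 1))) ->
  #|[set F in fillings D R C | S \subset block_starts D F s]| <=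
  #|[set F in fillings D R C | S \subset block_starts D F t]|.
Proof.
move=> k0 hjk youngD hfix hov.
(* A single filling marked at [S] yields the bounds on [S] itself, so one shuffle serves all
   fillings. *)
have [->|[F0]] :=
  set_0Vmem [set F in fillings D R C | S \subset block_starts D F s].
  by rewrite cards0.
rewrite 2!inE => /andP[/and3P[F0D _ _] /subsetP SF0].
have bound : {in S, forall a : 'I_n, a + k <= n}.
  by move=> a /SF0; apply: block_start_bound.
have spaced : {in S &, forall a a' : 'I_n, a < a' -> a + j <= a' /\ a + k <= a' + i}.
  move=> a a' /SF0 aS /SF0 a'S aa'.
  by have := block_starts_spaced F0D hov aS a'S aa'; lia.
rewrite -(card_imset _ (transport_inj hjk hfix bound spaced)).
apply/subset_leq_card/subsetP => _ /imsetP[F FX ->].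
move: FX; rewrite !inE => /andP[/and3P[FD FR FC] SF].
rewrite (filling_transport hjk) // (empty_rows_transport hjk) //.
by rewrite (empty_cols_transport hjk hfix bound spaced FD SF) FR FC (block_starts_transport hjk).
Qed.

Theorem theorem3p8 (k i j : nat) (s t : 'S_k.+1)
  (hi : 1 <= i) (hij : i < j) (hjk : j < k)
  (hperm : perm_eq (factor (word t) (i + 2) (j + 1))
                   (factor (word s) (i + 2) (j + 1)))
  (* x is the 0-based position of the 1-based index x.+1 *)
  (hfix : forall x : 'I_k.+1,
     (1 <= x.+1 <= i + 1) || (j + 2 <= x.+1 <= k + 1) -> t x = s x)
  (hoverlap : forall z : nat, minn i (k - j) < z -> z < k ->
     [/\ ~~ order_iso (factor (word s) 2 (z + 1))
                      (factor (word s) (k - z + 2) (k + 1)),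
         ~~ order_iso (factor (word s) 2 (z + 1))
                      (factor (word t) (k - z + 2) (k + 1)),
         ~~ order_iso (factor (word t) 2 (z + 1))
                      (factor (word s) (k - z + 2) (k + 1)) &
         ~~ order_iso (factor (word t) 2 (z + 1))
                      (factor (word t) (k - z + 2) (k + 1))]) :
  fs_equiv (one_dash s) (one_dash t).
Proof.
have k0 : 0 < k by lia.
(* The 1-based indices [i + 2] to [j + 1] are the 0-based positions [x] with [i < x <= j]. *)
have mid (x : 'I_k.+1) : ~~ (i < x <= j) -> t x = s x.
  by move=> h; apply: hfix; have := ltn_ord x; lia.
have mid' (x : 'I_k.+1) : ~~ (i < x <= j) -> s x = t x by move/mid.
move=> n m D youngD R C.
have avoidE (w : 'S_k.+1) :
    avoiders D (one_dash w) R C =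
      [set F in fillings D R C | block_starts D F w == set0].
  apply/setP => F; rewrite !inE contains_one_dash // negbK.
  by rewrite -andbA andbA [_ && (_ == set0)]andbC -!andbA andbCA; do !bool_congr.
rewrite !avoidE; apply: eq_card_fibers => S.
(* The hypotheses are symmetric in [s] and [t], so the injection is available in both directions. *)
apply/eqP; rewrite eqn_leq; apply/andP.
split; [apply: (leq_card_marked _ _ _ k0 (ltnW hjk) youngD mid)
       | apply: (leq_card_marked _ _ _ k0 (ltnW hjk) youngD mid')];
  by move=> z z1 z2; case: (hoverlap z z1 z2).
Qed.
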